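(* Let $n\ge 21$ be an integer and suppose that $M$ is a minimum MOPLS($n$), that is, an MOPLS($n$) with exactly $F=\lceil n^2/3\rceil$ filled cells. Then $M$ can be partitioned into three OLSs on different point sets, with orders that sum to $n$ and are each either $\lfloor n/3\rfloor$ or $\lfloor n/3\rfloor+1$.
   Context: A partial Latin square of order $n$, PLS($n$), is an $n\times n$ array, each of whose cells is either empty or filled with one element of a fixed $n$-element set of entries, such that each element of the entry set occurs at most once in every row and at most once in every column. Two partial Latin squares of the same order $n$ having the same filled cells as one another are orthogonal if, when superimposed, each of the $n^2$ possible ordered pairs (first entry, second entry) appears at most once in the cells of the superimposed square. An OPLS($n$) is the superimposed array of such a pair: an $n\times n$ array in which each cell is either empty or filled with an ordered pair (first entry, second entry), where first entries come from a fixed $n$-element set and second entries come from a fixed $n$-element set, such that each first entry symbol occurs at most once in each row and at most once in each column, likewise each second entry symbol, and each ordered pair of symbols occurs in at most one cell. An MOPLS($n$) is a maximal OPLS($n$), i.e. an OPLS($n$) that cannot be extended to another OPLS($n$) (with the same row, column, first entry and second entry sets) by inserting any entry pair into any empty cell. For $n\ge 21$ the minimum possible number of filled cells in an MOPLS($n$) is $\lceil n^2/3\rceil$. An OLS($k$) is a superimposed pair of orthogonal Latin squares of order $k$: a $k\times k$ array with every cell filled by an ordered pair, such that the first entries form a Latin square of order $k$ on a $k$-element set, the second entries form a Latin square of order $k$ on a $k$-element set, and each of the $k^2$ ordered pairs of symbols occurs in exactly one cell. ''$M$ can be partitioned into three OLSs on different point sets with orders $k_1,k_2,k_3$ summing to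 $n$'' means: the set of rows, the set of columns, the set of first entry symbols and the set of second entry symbols of $M$ can each be partitioned into three parts, $R_1,R_2,R_3$; $C_1,C_2,C_3$; $Y_1,Y_2,Y_3$; $Z_1,Z_2,Z_3$ respectively, with $|R_i|=|C_i|=|Y_i|=|Z_i|=k_i$, such that the filled cells of $M$ are exactly those of $\bigcup_{i=1}^3 R_i\times C_i$, and for each $i$ the subarray of $M$ on $R_i\times C_i$ is an OLS($k_i$) with first entry set $Y_i$ and second entry set $Z_i$. (Equivalently, up to permuting rows and columns, $M$ consists of three OLSs on disjoint entry sets placed down the leading diagonal, all other cells being empty.) *)

(* Defs.v *)
From mathcomp Require Import all_boot all_algebra.

Set Implicit Arguments.
Unset Strict Implicit.
Unset Printing Implicit Defensive.

(* Rows, columns, first-entry symbols and second-entry symbols are four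
   independent copies of 'I_n; an empty cell is None. *)
Definition parray (n : nat) (E : Type) := 'M[option E]_n.

Definition pairarray (n : nat) := parray n ('I_n * 'I_n).

Definition first_entries n (M : pairarray n) : parray n 'I_n :=
  map_mx (omap fst) M.

Definition second_entries n (M : pairarray n) : parray n 'I_n :=
  map_mx (omap snd) M.

Definition filled n (M : pairarray n) : {set 'I_n * 'I_n} :=
  [set rc | isSome (M rc.1 rc.2)].

Definition is_PLS n (L : parray n 'I_n) : Prop :=
  (forall r c c' y, L r c = Some y -> L r c' = Some y -> c = c') /\
  (forall r r' c y, L r c = Some y -> L r' c = Some y -> r = r').

Definition is_OPLS n (M : pairarray n) : Prop :=
  [/\ is_PLS (first_entries M),
      is_PLS (second_entries M)
    & forall r c r' c' e,
        M r c = Some e -> M r' c' = Some e -> (r, c) = (r', c')].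

Definition insert_entry n (M : pairarray n) (r c : 'I_n) (e : 'I_n * 'I_n) :
    pairarray n :=
  (\matrix_(r', c') if (r' == r) && (c' == c) then Some e else M r' c')%R.

Definition is_MOPLS n (M : pairarray n) : Prop :=
  is_OPLS M /\
  (forall r c e, M r c = None -> ~ is_OPLS (insert_entry M r c e)).

Definition ceil_div (m d : nat) : nat := (m + d.-1) %/ d.

Lemma ceil_div_leq m d k : 0 < d -> (ceil_div m d <= k) = (m <= k * d).
Proof.
case: d => // d _.
by rewrite /ceil_div /= -ltnS ltn_divLR // mulSn addSn addnC ltnS leq_add2l.
Qed.

Definition is_minimum_MOPLS n (M : pairarray n) : Prop :=
  is_MOPLS M /\ #|filled M| = ceil_div (n ^ 2) 3.

(* The subarray of L on R x C is a Latin square of order k with symbol set Y. *)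
Definition is_LS_on n (L : parray n 'I_n) (R C Y : {set 'I_n}) (k : nat)
    : Prop :=
  [/\ [/\ #|R| = k, #|C| = k & #|Y| = k],
      forall r c, r \in R -> c \in C -> exists2 y, y \in Y & L r c = Some y,
      forall r y, r \in R -> y \in Y ->
        exists! c, c \in C /\ L r c = Some y
    & forall c y, c \in C -> y \in Y ->
        exists! r, r \in R /\ L r c = Some y].

(* The subarray of M on R x C is an OLS(k) with first entry set Y and second
   entry set Z. *)
Definition is_OLS_on n (M : pairarray n) (R C Y Z : {set 'I_n}) (k : nat)
    : Prop :=
  [/\ is_LS_on (first_entries M) R C Y k,
      is_LS_on (second_entries M) R C Z k
    & forall y z, y \in Y -> z \in Z ->
        exists! rc, rc \in setX R C /\ M rc.1 rc.2 = Some (y, z)].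

Definition is_indexed_partition n (P : 'I_3 -> {set 'I_n}) : Prop :=
  (forall i j, i != j -> [disjoint P i & P j]) /\ \bigcup_i P i = [set: 'I_n].

Definition partitioned_into_three_OLSs n (M : pairarray n) (k : 'I_3 -> nat)
    : Prop :=
  exists R C Y Z : 'I_3 -> {set 'I_n},
    [/\ [/\ is_indexed_partition R, is_indexed_partition C,
            is_indexed_partition Y & is_indexed_partition Z],
        filled M = \bigcup_i setX (R i) (C i)
      & forall i, is_OLS_on M (R i) (C i) (Y i) (Z i) (k i)].

(* Main.v *)
Require Import Defs.
From mathcomp Require Import all_boot all_algebra.
From mathcomp Require Import zify.

Set Implicit Arguments.
Unset Strict Implicit.
Unset Printing Implicit Defensive.

(** Read a filled cell (r, c) with entry pair (y, z) as a word r c y z of length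
four.  An array is an OPLS exactly when two distinct words agree in at most one
coordinate (the code is separated), and maximality says that every quadruple
agrees with some word in at least two coordinates (the code is covering).  In
this form the four coordinates play symmetric roles.  Call two values of
different coordinates adjacent when some word contains both; a value of degree d,
that is lying in d words, then has exactly d neighbours in each other
coordinate.

Lower bound.  Let v be a value of least degree d, w a value of least degree d'
among those not adjacent to v, and p, q the two coordinates of neither.  Covering
forces a p-value and a q-value that avoid all neighbours of v and w to be
adjacent.  Counting words by their p-value (neighbours of v; neighbours of w; the
rest, of which each is adjacent to the whole rest of q) gives at least
d^2 + d'^2 + (n - d - d')^2 words when 2d' <= n - d, and n^2/3 is the minimum
of this expression; for larger d' already d^2 + (n - d)d' is large enough
(deg_lower_bound).

Equality.  With k = n/3 and e = (n - k)/2, rounded down, the size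
k^2 + e^2 + (n - k - e)^2 is exactly the minimum size, so every inequality used is
tight for each v of degree k and each w of degree at most e not adjacent to it
(tight_pair): v and w have no common neighbour, their neighbours in p have
degrees k and e, and each remaining p-value is adjacent to precisely the remaining
q-values.

Blocks.  That v and w without adjacency share no neighbour is a transitivity
property: a neighbour of a neighbour of a degree-k value is a neighbour.  So the
words met from one degree-k value fill a block, a choice of one set of values per
coordinate such that a value in one set is adjacent exactly to the other sets
(first_block).  Outside it the values of degree e behave in the same way and give
a second block (second_block), and what remains is a third block (three_blocks).
A block of a separated code is an OLS on its row, column and entry sets
(block_OLS). *)

(** * Arithmetic of the extremal size *)

(** Equality holds at u = v = e.  Lowering v increases the right side, as m - u >= 0;
then, for v = e, so does lowering u, as m - e >= e. *)
Lemma two_squares m e u v : e.*2 <= m -> u <= e -> v <= e ->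
  e ^ 2 + (m - e) ^ 2 <= u * e + (m - u) * (m - v).
Proof.
move=> em ue ve; have -> : m = e + e + (m - e.*2) by lia.
move: (m - e.*2) => s; have -> : u = e - (e - u) by lia.
have -> : v = e - (e - v) by lia.
move: (e - u) (e - v) (leq_subr u e) (leq_subr v e) => u' v' u'e v'e.
have -> : e + e + s - (e - u') = e + s + u' by lia.
have -> : e + e + s - (e - v') = e + s + v' by lia.
have -> : e + e + s - e = e + s by lia.
rewrite mulnBl; nia.
Qed.

(** For m = 2e the bound is attained for every u as soon as v = e, so only v is
determined; u is recovered later by exchanging two coordinates. *)
Lemma two_squares_tight m e u v : 0 < e -> e.*2 <= m -> m <= e.*2.+1 ->
  u <= e -> v <= e ->
  u * e + (m - u) * (m - v) <= e ^ 2 + (m - e) ^ 2 -> v = e.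
Proof.
move=> e0 em me ue ve; have [//|nve] := eqVneq v e => bad; exfalso.
have [y [y0 ye vE]] : exists y, [/\ 0 < y, y <= e & v = e - y].
  by exists (e - v); split; lia.
have [x [xe uE]] : exists x, x <= e /\ u = e - x by exists (e - u); lia.
have [s [s1 mE]] : exists s, s <= 1 /\ m = e + e + s by exists (m - e.*2); lia.
move: bad; rewrite (_ : m - u = e + s + x); last by lia.
rewrite (_ : m - v = e + s + y); last by lia.
rewrite (_ : m - e = e + s); last by lia.
rewrite {}uE mulnBl -!mulnn; clear -e0 y0 xe s1.
have xee : x * e <= e * e by rewrite leq_mul2r xe orbT.
nia.
Qed.

(** A, B and C are the degree sums over the three classes of values in
tight_sums: their lower bounds already add up to the total. *)
Lemma tight_arith m e k u v A B C : 0 < e -> e.*2 <= m -> m <= e.*2.+1 ->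
  k * k <= A -> u * e <= B -> (m - u) * (m - v) <= C -> u <= e -> v <= e ->
  A + B + C = k ^ 2 + e ^ 2 + (m - e) ^ 2 ->
  [/\ v = e, A <= k * k & u = e -> B <= e * e /\ C <= (m - e) * (m - e)].
Proof.
move=> e0 em me kA uB uC ue ve; have sq := two_squares em ue ve.
have tight := two_squares_tight e0 em me ue ve.
rewrite -!mulnn in sq tight * => sum_eq.
have vE : v = e by apply: tight; clear -kA uB uC sum_eq; lia.
split=> //; first by clear -sq uB uC sum_eq; lia.
by move=> uE; rewrite uE vE in uB uC; split; clear -kA uB uC sum_eq; lia.
Qed.

Lemma half_square d m : d.*2 <= m -> m ^ 2 <= 2 * (d ^ 2 + (m - d) ^ 2).
Proof.
move=> dm; have [t ->] : exists t, m = d + (d + t) by exists (m - d - d); lia.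
by rewrite addKn -!mulnn; clear; nia.
Qed.

(** The left side is t^2 * 2/3 + 3(x - t/3)^2 and the right side is at most
(t^2 + 2) * 2/3, so x is within 2/3 of t/3. *)
Lemma min_deg_arith t k e x : 0 < k ->
  [\/ t = k * 3 /\ e = k, t = k * 3 + 1 /\ e = k | t = k * 3 + 2 /\ e = k.+1] ->
  2 * x ^ 2 + (t - x) ^ 2 <= 2 * (k ^ 2 + e ^ 2 + (t - k - e) ^ 2) -> k <= x.
Proof.
move=> k0 orders; rewrite leqNgt => bound; apply/negP => xk; move: bound.
have [u [u0 kE]] : exists u, 0 < u /\ k = x + u by exists (k - x); lia.
case: orders => -[-> ->]; rewrite {}kE.
- rewrite (_ : _ - x = x * 2 + u * 3); last by lia.
  rewrite (_ : _ - _ - _ = x + u); last by lia.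
  rewrite -!mulnn; nia.
- rewrite (_ : _ - x = x * 2 + u * 3 + 1); last by lia.
  rewrite (_ : _ - _ - _ = x + u + 1); last by lia.
  rewrite -!mulnn; nia.
- rewrite (_ : _ - x = x * 2 + u * 3 + 2); last by lia.
  rewrite (_ : _ - _ - _ = x + u + 1); last by lia.
  rewrite -!mulnn; nia.
Qed.

Lemma minimum_size n :
  ceil_div (n ^ 2) 3 = (n %/ 3) ^ 2 + ((n - n %/ 3)./2) ^ 2
                       + (n - n %/ 3 - (n - n %/ 3)./2) ^ 2 /\
  [\/ n = n %/ 3 * 3 /\ (n - n %/ 3)./2 = n %/ 3,
      n = n %/ 3 * 3 + 1 /\ (n - n %/ 3)./2 = n %/ 3
    | n = n %/ 3 * 3 + 2 /\ (n - n %/ 3)./2 = (n %/ 3).+1].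
Proof.
have : n %% 3 < 3 by rewrite ltn_mod.
have := divn_eq n 3; move: (n %/ 3) (n %% 3) => k rho -> rho3.
have ceilE F m : F * 3 <= m + 2 -> m + 2 < F.+1 * 3 -> ceil_div m 3 = F.
  by move=> Fm mF; rewrite /ceil_div; lia.
case: rho rho3 => [|[|[|//]]] _.
- have eE : (k * 3 + 0 - k)./2 = k by lia.
  rewrite eE (_ : _ - _ - _ = k); last by lia.
  by split; [apply: ceilE; rewrite -!mulnn; nia|constructor 1; lia].
- have eE : (k * 3 + 1 - k)./2 = k by lia.
  rewrite eE (_ : _ - _ - _ = k + 1); last by lia.
  by split; [apply: ceilE; rewrite -!mulnn; nia|constructor 2; lia].
- have eE : (k * 3 + 2 - k)./2 = k.+1 by lia.
  rewrite eE (_ : _ - _ - _ = k.+1); last by lia.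
  by split; [apply: ceilE; rewrite -!mulnn; nia|constructor 3; lia].
Qed.

(** * Indices and finite sums *)

Lemma fresh_index (s : seq 'I_4) : uniq s -> size s < 4 ->
  exists l, uniq (l :: s).
Proof.
move=> us ss; case: (pickP (fun l => l \notin s)) => [l ls|all_in].
  by exists l; rewrite /= ls.
have : size (enum 'I_4) <= size s.
  by apply: uniq_leq_size (enum_uniq _) _ => l _; move: (all_in l) => /negbFE.
by rewrite size_enum_ord leqNgt ss.
Qed.

Lemma four_indices (s : seq 'I_4) l : uniq s -> size s = 4 -> l \in s.
Proof.
move=> us ss; apply/negPn/negP => ls.
have : size (l :: s) <= size (enum 'I_4).
  by apply: uniq_leq_size; [rewrite /= ls|move=> x _; rewrite mem_enum].
by rewrite size_enum_ord /= ss.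
Qed.

Lemma fourP (i j p q : 'I_4) : uniq [:: i; j; p; q] ->
  [/\ i != j, i != p, i != q, j != p & (j != q) && (p != q)].
Proof.
by rewrite /= !inE !negb_or -!andbA => /and5P[-> -> -> -> /and3P[-> -> _]].
Qed.

Lemma complete_indices (i j : 'I_4) : i != j ->
  exists p q, uniq [:: i; j; p; q].
Proof.
move=> ij; have [||q uq] := @fresh_index [:: i; j] => //; first by rewrite /= inE ij.
have [||p up] := @fresh_index [:: q; i; j] => //.
by exists p, q; rewrite -(rot_uniq 2).
Qed.

Lemma fourth_index (i j p : 'I_4) : uniq [:: i; j; p] ->
  exists q, uniq [:: i; j; p; q].
Proof.
move=> us; have [//|q uq] := fresh_index us.
by exists q; rewrite -(rot_uniq 3).
Qed.

(** Case analysis on literal ordinals, which nth reduces on. *)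
Lemma part_cases (Q : 'I_3 -> Prop) :
  Q (@Ordinal 3 0 isT) -> Q (@Ordinal 3 1 isT) -> Q (@Ordinal 3 2 isT) ->
  forall m, Q m.
Proof. by move=> Q0 Q1 Q2 [[|[|[|//]]] lt]; rewrite (bool_irrelevance lt isT). Qed.

Section FiniteSums.
Variable T : finType.

Lemma card_setCU (A B : {set T}) : #|~: (A :|: B)| = #|T| - #|A| - #|B :\: A|.
Proof.
rewrite cardsCs setCK cardsU cardsD (setIC B) -subnDA addnBA //.
by rewrite subset_leq_card ?subsetIr.
Qed.

Lemma sum_ge (A : {set T}) (f : T -> nat) d : {in A, forall c, d <= f c} ->
  #|A| * d <= \sum_(c in A) f c.
Proof. by move=> dA; rewrite -sum_nat_const leq_sum. Qed.

Lemma sum_tight (A : {set T}) (f : T -> nat) d : {in A, forall c, d <= f c} ->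
  \sum_(c in A) f c <= #|A| * d -> {in A, forall c, f c = d}.
Proof.
move=> dA; rewrite -sum_nat_const => le_sum c cA; apply/esym/eqP.
have := leqif_sum (I := T) (P := mem A) (E1 := fun=> d) (E2 := f)
          (C := fun i => d == f i) (fun i iA => conj (dA i iA) erefl).
by case=> ge_sum; rewrite eqn_leq ge_sum le_sum => /esym/forall_inP; apply.
Qed.

End FiniteSums.

(** * Codes of words with four coordinates *)

Section Code.
Variables (T : finType) (S : {set {ffun 'I_4 -> T}}).

Definition separated := forall x y (i j : 'I_4), x \in S -> y \in S -> i != j ->
  x i = y i -> x j = y j -> x = y.

Definition covering := forall t : {ffun 'I_4 -> T}, exists x (i j : 'I_4),
  [/\ x \in S, i != j, x i = t i & x j = t j].

Definition deg (i : 'I_4) a := #|[set x in S | x i == a]|.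

Definition nbr (i : 'I_4) a (j : 'I_4) :=
  [set x j | x : {ffun 'I_4 -> T} in [set x in S | x i == a]].

Lemma nbrP i a j c :
  reflect (exists x, [/\ x \in S, x i = a & x j = c]) (c \in nbr i a j).
Proof.
apply: (iffP imsetP) => [[x]|[x [xS xi xj]]].
  by rewrite inE => /andP[xS /eqP xi] ->; exists x.
by exists x; rewrite // inE xS xi eqxx.
Qed.

Lemma nbr_sym i a j c : (c \in nbr i a j) = (a \in nbr j c i).
Proof. by apply/nbrP/nbrP => -[x [xS xi xj]]; exists x. Qed.

Lemma sum_deg i : \sum_a deg i a = #|S|.
Proof.
rewrite -sum1_card (partition_big (fun x : {ffun 'I_4 -> T} => x i) xpredT) //=.
apply: eq_bigr => a _; rewrite /deg -sum1_card.
by apply: eq_bigl => x; rewrite inE.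
Qed.

Hypothesis sepS : separated.

Lemma card_nbr i a j : i != j -> #|nbr i a j| = deg i a.
Proof.
move=> ij; apply: card_in_imset => x y; rewrite !inE.
move=> /andP[xS /eqP xi] /andP[yS /eqP yi] xy.
by apply: (sepS (i := i) (j := j)) => //; rewrite xi yi.
Qed.

(** The complete 4-partite components of adjacency, one set of values for each
coordinate. *)
Definition block (B : 'I_4 -> {set T}) :=
  forall i j a, i != j -> a \in B i -> nbr i a j = B j.

(** The hypothesis on D is transitivity of adjacency near the values in D.  Starting
from a word x through a, the set of coordinate j is the neighbourhood of any other
value of x; transitivity makes it independent of that choice. *)
Lemma block_of (D : 'I_4 -> pred T) :
  (forall i p q a c, uniq [:: i; p; q] -> D i a -> c \in nbr i a p ->
     D p c /\ nbr p c q = nbr i a q) ->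
  forall i a, D i a -> 0 < deg i a ->
  exists B, [/\ block B, a \in B i & forall j, {in B j, forall c, D j c}].
Proof.
move=> Dtrans i0 a0 Da0 /card_gt0P[x]; rewrite inE => /andP[xS /eqP xi0].
have Dstep i p a c : i != p -> D i a -> c \in nbr i a p -> D p c.
  move=> ip Da ca; have [||q] := @fresh_index [:: i; p] => //=.
    by rewrite inE ip.
  rewrite !inE negb_or -!andbA => /and4P[qi qp _ _].
  case: (Dtrans i p q a c) => //.
  by rewrite /= !inE negb_or ip eq_sym qi eq_sym qp.
have Dx i : D i (x i).
  have [<-|ii0] := eqVneq i0 i; first by rewrite xi0.
  by apply: (Dstep i0 i a0) => //; apply/nbrP; exists x.
have xnbr i j l : i != j -> l != j -> nbr i (x i) j = nbr l (x l) j.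
  move=> ij lj; have [->//|il] := eqVneq i l.
  case: (Dtrans i l j (x i) (x l)) => //.
    by rewrite /= !inE negb_or il ij lj.
  by apply/nbrP; exists x.
(* nx j is an arbitrary coordinate other than j. *)
pose nx (j : 'I_4) : 'I_4 := if j == ord0 then ord_max else ord0.
have nxj j : nx j != j by rewrite /nx; case: (eqVneq j ord0) => [->|]; rewrite // eq_sym.
have Bx i j : i != j -> nbr (nx j) (x (nx j)) j = nbr i (x i) j.
  by move=> ij; apply: xnbr.
exists (fun j => nbr (nx j) (x (nx j)) j); split.
- move=> i j a ij.
  have [||l] := @fresh_index [:: i; j] => //=; first by rewrite inE ij.
  rewrite !inE negb_or -!andbA => /and4P[li lj _ _].
  rewrite (Bx l) // (Bx l) // => al.
  case: (Dtrans l i j (x l) a) => //.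
  by rewrite /= !inE negb_or li lj ij.
- by apply/nbrP; exists x.
- by move=> j c /(Dstep _ _ _ _ (nxj j)); apply.
Qed.

Lemma block_card B i j a : block B -> i != j -> a \in B i -> #|B j| = deg i a.
Proof. by move=> Bb ij aB; rewrite -(card_nbr a ij) (Bb i j). Qed.

Lemma block_closed B x i j : block B -> x \in S -> x i \in B i -> x j \in B j.
Proof.
move=> Bb xS xi; have [<-//|ij] := eqVneq i j.
by rewrite -(Bb i j _ ij xi); apply/nbrP; exists x.
Qed.

Hypothesis covS : covering.

(** A word that meets the quadruple a, b, c, d twice can only do so in c and d. *)
Lemma cover_rest i j p q a b c d : uniq [:: i; j; p; q] ->
  b \notin nbr i a j -> c \notin nbr i a p :|: nbr j b p ->
  d \notin nbr i a q :|: nbr j b q -> d \in nbr p c q.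
Proof.
move=> uq ab; rewrite !inE !negb_or => /andP[ac bc] /andP[ad bd].
pose t := [ffun l => if l == i then a else if l == j then b else
                     if l == p then c else d].
have [x [l [l' [xS ll' xl xl']]]] := covS t.
have {x xS xl xl'} : t l' \in nbr l (t l) l' by apply/nbrP; exists x.
have lin := four_indices l uq erefl; have l'in := four_indices l' uq erefl.
have [ij ip iq jp /andP[jq pq]] := fourP uq.
have ti : t i = a by rewrite ffunE eqxx.
have tj : t j = b by rewrite ffunE eq_sym (negPf ij) eqxx.
have tp : t p = c by rewrite ffunE !(eq_sym p) (negPf ip) (negPf jp) eqxx.
have tq : t q = d by rewrite ffunE !(eq_sym q) (negPf iq) (negPf jq) (negPf pq).
have nonadj := (negPf ab, negPf ac, negPf ad, negPf bc, negPf bd).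
move: lin l'in ll'; rewrite !inE => /or4P[]/eqP-> /or4P[]/eqP->; rewrite ?eqxx //.
all: by move=> _; rewrite ?(ti, tj, tp, tq) ?nonadj // [X in is_true X -> _]nbr_sym ?nonadj.
Qed.

Lemma sum_deg_split p (A B : {set T}) :
  #|S| = \sum_(c in A) deg p c + \sum_(c in B :\: A) deg p c +
         \sum_(c in ~: (A :|: B)) deg p c.
Proof.
rewrite -(sum_deg p) (bigID (mem A)) /= -addnA; congr addn.
rewrite (bigID (mem B)) /=; congr addn; apply: eq_bigl => c; rewrite !inE //.
by rewrite negb_or.
Qed.

Section NonAdjacentPair.
Variables (i j p q : 'I_4) (a b : T).
Hypotheses (uq : uniq [:: i; j; p; q]) (ab : b \notin nbr i a j).

Lemma subset_nbr_rest c : c \notin nbr i a p :|: nbr j b p ->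
  ~: (nbr i a q :|: nbr j b q) \subset nbr p c q.
Proof. by move=> cN; apply/subsetP => d; rewrite inE => /(cover_rest uq ab cN). Qed.

Lemma deg_rest c : c \notin nbr i a p :|: nbr j b p ->
  #|~: (nbr i a q :|: nbr j b q)| <= deg p c.
Proof.
move/subset_nbr_rest/subset_leq_card; rewrite (@card_nbr p c) //.
by have [_ _ _ _ /andP[]] := fourP uq.
Qed.

End NonAdjacentPair.

(** Let d be the least degree among the values not adjacent to a, attained at b.
Counting words by a coordinate p other than those of a and b, the neighbours of a
contribute at least (deg i a)^2, and the other values have degree at least d.  If
d is small, the values adjacent to neither a nor b have a better bound, deg_rest,
and two_squares collects the contributions. *)
Lemma deg_lower_bound i a : (forall j b, deg i a <= deg j b) -> deg i a < #|T| ->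
  exists d, [/\ forall j b, j != i -> b \notin nbr i a j -> d <= deg j b
    & (d.*2 <= #|T| - deg i a) /\
        deg i a ^ 2 + d ^ 2 + (#|T| - deg i a - d) ^ 2 <= #|S|
      \/ #|T| - deg i a < d.*2 /\ deg i a ^ 2 + (#|T| - deg i a) * d <= #|S|].
Proof.
move=> amin aT.
have nonnbr j : j != i -> exists b, b \notin nbr i a j.
  move=> ji; case: (pickP (fun b => b \notin nbr i a j)) => [b|full].
    by exists b.
  have : #|T| <= #|nbr i a j|.
    by rewrite -cardsT subset_leq_card //; apply/subsetP => b _; exact/negbFE/full.
  by rewrite (card_nbr a) 1?eq_sym // leqNgt aT.
have [||j0] := @fresh_index [:: i] => //.
rewrite /= !inE andbT => j0i.
have [b0 b0a] := nonnbr j0 j0i.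
pose P (w : 'I_4 * T) := (w.1 != i) && (w.2 \notin nbr i a w.1).
have P0 : P (j0, b0) by rewrite /P /= j0i b0a.
case: (@arg_minnP _ (j0, b0) P (fun w => deg w.1 w.2) P0) => -[j b].
rewrite /P /= => /andP[ji ba] bmin.
have dmin l c : l != i -> c \notin nbr i a l -> deg j b <= deg l c.
  by move=> li cl; apply: (bmin (l, c)); rewrite /= li cl.
exists (deg j b); split=> //.
have [|p [q uq]] := @complete_indices i j; first by rewrite eq_sym.
have [ij ip iq jp /andP[jq pq]] := fourP uq.
set d := deg j b in dmin *; set k := deg i a in amin aT *.
have nA : #|nbr i a p| = k by rewrite card_nbr.
have sA : k ^ 2 <= \sum_(c in nbr i a p) deg p c.
  by rewrite -mulnn -{1}nA; apply: sum_ge => c _; apply: amin.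
case: (leqP d.*2 (#|T| - k)) => dk; [left|right]; split=> //.
  rewrite (sum_deg_split p (nbr i a p) (nbr j b p)).
  have sB : #|nbr j b p :\: nbr i a p| * d <=
      \sum_(c in nbr j b p :\: nbr i a p) deg p c.
    apply: sum_ge => c; rewrite inE => /andP[cA _].
    by apply: dmin; rewrite // eq_sym.
  have sC := sum_ge (fun c cC => deg_rest uq ba (c := c) (etrans (esym (in_setC _ _)) cC)).
  rewrite !card_setCU !card_nbr // -/k in sC.
  have uB : #|nbr j b p :\: nbr i a p| <= d.
    by rewrite /d -(card_nbr b jp) subset_leq_card ?subsetDl.
  have uB' : #|nbr j b q :\: nbr i a q| <= d.
    by rewrite /d -(card_nbr b jq) subset_leq_card ?subsetDl.
  rewrite -addnA -[X in _ <= X]addnA leq_add //.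
  apply: leq_trans (leq_add sB sC).
  exact: two_squares.
(* Here d exceeds (n - k) / 2, so the minimality of d alone is enough. *)
rewrite (sum_deg_split p (nbr i a p) set0) setU0 set0D big_set0 addn0 leq_add //.
rewrite -nA -[#|T|](cardsC (nbr i a p)) addKn.
by apply: sum_ge => c; rewrite inE => ca; apply: dmin => //; rewrite eq_sym.
Qed.

Section Extremal.
Variables k e : nat.
Hypothesis k_gt0 : 0 < k.
Hypothesis orders : [\/ #|T| = k * 3 /\ e = k, #|T| = k * 3 + 1 /\ e = k
  | #|T| = k * 3 + 2 /\ e = k.+1].
Hypothesis card_S : #|S| = k ^ 2 + e ^ 2 + (#|T| - k - e) ^ 2.

Lemma k_lt_card : k < #|T|.
Proof. case: orders => -[-> _]; lia. Qed.

Lemma e_half : e.*2 <= #|T| - k /\ #|T| - k <= e.*2.+1.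
Proof. case: orders => -[-> ->]; lia. Qed.

(** Averaging bounds the minimum degree by k from above, as the code has fewer than
n(k + 1) words; the lower bound on the size bounds it from below. *)
Lemma min_deg_exists : (forall j b, k <= deg j b) /\ exists i a, deg i a = k.
Proof.
have /card_gt0P[a0 _] : 0 < #|T| by apply: leq_ltn_trans k_lt_card.
case: (@arg_minnP _ (ord0 : 'I_4, a0) xpredT (fun w => deg w.1 w.2) isT).
move=> -[i a] _ /= amin'; have amin j b : deg i a <= deg j b by exact: (amin' (j, b)).
suff ka : deg i a = k by split; [move=> j b; rewrite -ka|exists i, a].
have le_sum : #|T| * deg i a <= #|S|.
  have := @sum_ge _ [set: T] (deg i) _ (fun c _ => amin i c).
  by rewrite cardsT (eq_bigl xpredT) ?sum_deg // => c; rewrite inE.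
have ak : deg i a <= k.
  rewrite leqNgt; apply/negP => ka; move: le_sum; rewrite card_S.
  move/(leq_trans (leq_mul (leqnn _) ka)).
  by case: orders => -[-> ->]; rewrite -!mulnn; clear -k_gt0; nia.
apply/eqP; rewrite eqn_leq ak leqNgt; apply/negP => ka.
have [d [_ bound]] := deg_lower_bound amin (leq_ltn_trans ak k_lt_card).
move: bound ka; rewrite card_S; move: (deg i a) => x {ak le_sum amin amin'}.
move=> bound xk.
have {bound} : 2 * x ^ 2 + (#|T| - x) ^ 2 <= 2 * (k ^ 2 + e ^ 2 + (#|T| - k - e) ^ 2).
  move: (k ^ 2 + e ^ 2 + _) bound => F; case=> -[]; move: (#|T| - x) => m.
    by move/half_square; clear; lia.
  by clear; nia.
by move/(min_deg_arith k_gt0 orders); rewrite leqNgt xk.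
Qed.

(** Two squares whose roots have a given sum have the least sum when the roots are
balanced, so with deg i a = k the lower bound leaves no room for d < e. *)
Lemma deg_nonnbr_ge i a : deg i a = k ->
  forall j b, j != i -> b \notin nbr i a j -> e <= deg j b.
Proof.
move=> ak; have amin j b : deg i a <= deg j b by rewrite ak; case: min_deg_exists.
have aT : deg i a < #|T| by rewrite ak k_lt_card.
have [d [dmin bound]] := deg_lower_bound amin aT.
move=> j b ji ba; apply: leq_trans (dmin _ _ ji ba).
move: bound; rewrite ak card_S.
have [] := e_half; move: (#|T| - k) => m; move=> em me.
case=> -[dm]; last by lia.
rewrite -!addnA leq_add2l leqNgt => le_sum; apply/negP => de; move: le_sum.
rewrite leqNgt => /negP[].
have [s ->] : exists s, m = e + e + s by exists (m - e.*2); lia.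
have [t [t0 ->]] : exists t, 0 < t /\ e = d + t by exists (e - d); lia.
rewrite (_ : _ - d = d + t + t + s); last by lia.
rewrite (_ : _ - _ = d + t + s); last by lia.
rewrite -!mulnn; nia.
Qed.

(** Otherwise counting words by coordinate j gives k^2 + (n - k)(e + 1) words, more
than there are. *)
Lemma nonnbr_exists i a j : deg i a = k -> j != i ->
  exists2 b, b \notin nbr i a j & deg j b <= e.
Proof.
move=> ak ji.
case: (pickP (fun b => (b \notin nbr i a j) && (deg j b <= e))) => [b /andP[]|none].
  by exists b.
have dk : k ^ 2 <= \sum_(c in nbr i a j) deg j c.
  rewrite -mulnn -{1}ak -(@card_nbr i a j) 1?eq_sym //.
  by apply: sum_ge => c _; case: min_deg_exists.
have de : (#|T| - k) * e.+1 <= \sum_(c in ~: nbr i a j) deg j c.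
  rewrite -ak -(@card_nbr i a j) 1?eq_sym // -[#|T|](cardsC (nbr i a j)) addKn.
  by apply: sum_ge => c; rewrite inE ltnNge => ca; have := none c; rewrite ca /= => ->.
have := leq_add dk de.
have -> : \sum_(c in nbr i a j) deg j c + \sum_(c in ~: nbr i a j) deg j c = #|S|.
  by rewrite (sum_deg_split j (nbr i a j) set0) setU0 set0D big_set0 addn0.
rewrite card_S -!addnA leq_add2l => bad; exfalso; move: bad.
have e_gt0 : 0 < e by case: orders => -[_ ->].
have [] := e_half; move: (#|T| - k) => m em me.
have [] : m = e + e \/ m = e + e + 1 by lia.
  by move=> ->; rewrite addKn -!mulnn; nia.
by move=> ->; rewrite -addnA addKn -!mulnn; nia.
Qed.

Section TightPair.
Variables (i j : 'I_4) (a b : T).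
Hypotheses (ij : i != j) (ak : deg i a = k) (be : deg j b <= e).
Hypothesis (ab : b \notin nbr i a j).

Lemma tight_deg : deg j b = e.
Proof. by apply/eqP; rewrite eqn_leq be (deg_nonnbr_ge ak) // eq_sym. Qed.

(** Both n - k = 2e and n - k = 2e + 1 occur; in the former case the count by p fixes
the number of new neighbours of b in q, and not in p, whence the implication
in the last part. *)
Lemma tight_sums p q : uniq [:: i; j; p; q] ->
  [/\ #|nbr j b q :\: nbr i a q| = e,
      \sum_(c in nbr i a p) deg p c <= k * k &
      #|nbr j b p :\: nbr i a p| = e ->
      \sum_(c in nbr j b p :\: nbr i a p) deg p c <= e * e /\
      \sum_(c in ~: (nbr i a p :|: nbr j b p)) deg p c
        <= (#|T| - k - e) * (#|T| - k - e)].
Proof.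
move=> uq; have [_ ip iq jp /andP[jq pq]] := fourP uq.
have degk := min_deg_exists.1; have dege := tight_deg.
have sA : k * k <= \sum_(c in nbr i a p) deg p c.
  by rewrite -{1}ak -(@card_nbr i a p) //; apply: sum_ge => c _.
have sB : #|nbr j b p :\: nbr i a p| * e <=
    \sum_(c in nbr j b p :\: nbr i a p) deg p c.
  apply: sum_ge => c; rewrite inE => /andP[cA _].
  by apply: (deg_nonnbr_ge ak); rewrite // eq_sym.
have sC := sum_ge (fun c cC => deg_rest uq ab (c := c) (etrans (esym (in_setC _ _)) cC)).
rewrite !card_setCU !card_nbr // ak in sC.
have uB : #|nbr j b p :\: nbr i a p| <= e.
  by rewrite -dege -(card_nbr b jp) subset_leq_card ?subsetDl.
have uB' : #|nbr j b q :\: nbr i a q| <= e.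
  by rewrite -dege -(card_nbr b jq) subset_leq_card ?subsetDl.
have := sum_deg_split p (nbr i a p) (nbr j b p).
rewrite card_S.
move: sA sB sC uB uB'.
have [] := e_half; move: (#|T| - k) => m em me.
move: (#|nbr j b p :\: _|) (#|nbr j b q :\: _|) => u v.
move: (\sum_(c in nbr i a p) _) (\sum_(c in nbr j b p :\: _) _) => A B.
move: (\sum_(c in _) _) => C kA uB uC ue ve sum_eq.
have e_gt0 : 0 < e by case: orders => -[_ ->].
exact: (tight_arith e_gt0 em me).
Qed.

(** Equality holds throughout the count of deg_lower_bound, read both by p and by
q. *)
Lemma tight_pair p q : uniq [:: i; j; p; q] ->
  [/\ [disjoint nbr i a p & nbr j b p],
      {in nbr i a p, forall c, deg p c = k},
      {in nbr j b p, forall c, deg p c = e} &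
      forall c, c \notin nbr i a p :|: nbr j b p ->
        nbr p c q = ~: (nbr i a q :|: nbr j b q)].
Proof.
move=> uq; have [_ ip iq jp /andP[jq pq]] := fourP uq.
have degk := min_deg_exists.1.
have uq' : uniq [:: i; j; q; p].
  by rewrite -(perm_uniq (s1 := [:: i; j; p; q])) // !perm_cons (perm_catC [:: p] [:: q]).
have [qe sA tightBC] := tight_sums uq; have [pe _ _] := tight_sums uq'.
have [sB sC] := tightBC pe.
(* b has e neighbours in p, and e of them are not neighbours of a. *)
have Dp : nbr j b p :\: nbr i a p = nbr j b p.
  apply/eqP; rewrite eqEcard subsetDl pe card_nbr // tight_deg //.
split.
- by rewrite disjoint_sym -Dp disjoints_subset setDE subsetIr.
- apply: sum_tight => [c _|]; first exact: degk.
  by rewrite card_nbr // ak.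
- rewrite -Dp; apply: sum_tight; last by rewrite pe.
  by move=> c; rewrite inE => /andP[ca _]; apply: (deg_nonnbr_ge ak); rewrite // eq_sym.
- have card_rest r : r != i -> r != j -> #|nbr j b r :\: nbr i a r| = e ->
      #|~: (nbr i a r :|: nbr j b r)| = #|T| - k - e.
    by move=> ri rj re; rewrite card_setCU re card_nbr 1?eq_sym // ak.
  move=> c cN; apply/esym/eqP; rewrite eqEcard (subset_nbr_rest uq) //=.
  rewrite (@card_nbr p c) // card_rest 1?eq_sym //.
  have pr : #|~: (nbr i a p :|: nbr j b p)| = #|T| - k - e by rewrite card_rest 1?eq_sym.
  rewrite (@sum_tight _ (~: (nbr i a p :|: nbr j b p)) (deg p) (#|T| - k - e)) ?inE //.
  + move=> c' c'N; rewrite -(card_rest q) 1?eq_sym //.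
    by apply: (deg_rest uq ab); rewrite inE in c'N.
  + by rewrite pr.
  + by rewrite inE in cN.
Qed.

End TightPair.

(** A neighbour d of c not adjacent to a would have c as a common neighbour with a,
although a and d, both of degree k, would form a tight pair, which has none. *)
Lemma deg_k_neighbour i p q a c : uniq [:: i; p; q] -> deg i a = k ->
  c \in nbr i a p -> deg p c = k /\ nbr p c q = nbr i a q.
Proof.
rewrite /= !inE negb_or -andbA andbT => /and3P[ip iq pq] ak ca.
have nbr_deg i' p' a' c' : i' != p' -> deg i' a' = k -> c' \in nbr i' a' p' ->
    deg p' c' = k.
  move=> ip' ak' ca'; have [||j] := @fresh_index [:: i'; p'] => //.
    by rewrite /= inE ip'.
  rewrite /= !inE negb_or ip' !andbT => /andP[ji jp].
  have [b ab be] := nonnbr_exists ak' ji.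
  have ij : i' != j by rewrite eq_sym.
  have [|r ur] := @fourth_index i' j p'; first by rewrite /= !inE negb_or ij ip' jp.
  by have [_ degA _ _] := tight_pair ij ak' be ab ur; apply: degA.
have ck := nbr_deg _ _ _ _ ip ak ca; split=> //.
apply/eqP; rewrite eqEcard !card_nbr // ck ak leqnn andbT.
apply/subsetP => d dc; apply/negPn/negP => ad.
have dk := nbr_deg _ _ _ _ pq ck dc.
have [|r ur] := @fourth_index i q p; first by rewrite /= !inE negb_or iq ip eq_sym pq.
have de : deg q d <= e by rewrite dk; case: orders => -[_ ->].
have [dis _ _ _] := tight_pair iq ak de ad ur.
have := disjointFr dis ca; rewrite nbr_sym in dc.
by rewrite dc.
Qed.

Lemma first_block : exists A, block A /\ forall j, #|A j| = k.
Proof.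
have [_ [i [a ak]]] := min_deg_exists.
have [|||A [bA aA degA]] := @block_of (fun i a => deg i a == k) _ i a.
- move=> i' p q a' c uq /eqP ak' ca.
  by have [-> ->] := deg_k_neighbour uq ak' ca.
- exact/eqP.
- by rewrite ak.
have A_card j l : l != j -> (exists x, x \in A l) -> #|A j| = k.
  by move=> lj [x xA]; rewrite (block_card bA lj xA); apply/eqP/(degA l).
have A_ne l : exists x, x \in A l.
  have [<-|il] := eqVneq i l; first by exists a.
  by apply/set0Pn; rewrite -card_gt0 (A_card l i) //; exists a.
exists A; split=> // j; have [||l] := @fresh_index [:: j] => //.
by rewrite /= inE andbT => lj; apply: (A_card j l).
Qed.

Section SecondBlock.
Variables (A : 'I_4 -> {set T}) (bA : block A) (A_card : forall j, #|A j| = k).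

Lemma first_block_value i : exists2 a, a \in A i & deg i a = k.
Proof.
have /card_gt0P[a aA] : 0 < #|A i| by rewrite A_card.
exists a => //; have [||l] := @fresh_index [:: i] => //.
by rewrite /= inE andbT eq_sym => il; rewrite -(block_card bA il aA).
Qed.

(** Values outside the block A are adjacent to nothing in A, so each of them of degree
at most e forms a tight pair with a value of A. *)
Lemma outside_pair i j p q b : uniq [:: i; j; p; q] ->
  b \notin A j -> deg j b <= e ->
  [/\ {in nbr j b p, forall c, c \notin A p /\ deg p c = e} &
      forall c, c \notin A p :|: nbr j b p -> nbr p c q = ~: (A q :|: nbr j b q)].
Proof.
move=> uq bN be; have [ij ip iq jp _] := fourP uq.
have [a aA ak] := first_block_value i.
have ab : b \notin nbr i a j by rewrite (bA ij aA).
have [dis _ dege] := tight_pair ij ak be ab uq.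
rewrite !(bA _ aA) // in dis * => rest; split=> // c cb.
by rewrite (disjointFl dis cb) dege.
Qed.

(** A neighbour d of c not adjacent to b would be one of the remaining values for the
tight pair of b with A, hence adjacent to no neighbour of b, yet it is adjacent
to c. *)
Lemma deg_e_neighbour j p q b c : uniq [:: j; p; q] ->
  b \notin A j -> deg j b = e -> c \in nbr j b p ->
  [/\ c \notin A p, deg p c = e & nbr p c q = nbr j b q].
Proof.
move=> uq3 bN be cb; have be' : deg j b <= e by rewrite be.
have [//||i uq] := @fresh_index [:: j; p; q]; first by [].
have [_ _ _ jp /andP[jq pq]] := fourP uq.
have [/(_ c cb)[cN ce] _] := outside_pair uq bN be'.
split=> //; apply/eqP; rewrite eqEcard !card_nbr // ce be leqnn andbT.
have uq' : uniq [:: i; j; q; p].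
  by rewrite -(perm_uniq (s1 := [:: i; j; p; q])) // !perm_cons (perm_catC [:: p] [:: q]).
have [_ rest] := outside_pair uq' bN be'.
apply/subsetP => d dc; apply/negPn/negP => bd.
have dN : d \notin A q.
  have ce' : deg p c <= e by rewrite ce.
  have uqc : uniq [:: i; p; q; j].
    by rewrite -(perm_uniq (s1 := [:: i; j; p; q])) // perm_cons (perm_catC [:: j] [:: p; q]).
  by have [/(_ d dc)[]] := outside_pair uqc cN ce'.
have := rest d; rewrite inE negb_or dN bd => /(_ isT) /setP/(_ c).
by rewrite -nbr_sym dc !inE cb orbT.
Qed.

Lemma second_block : exists B, block B /\
  (forall j, #|B j| = e /\ [disjoint A j & B j]).
Proof.
have [a aA ak] := first_block_value ord_max.
have [b ab be] := nonnbr_exists (j := ord0) ak isT.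
have bN : b \notin A ord0 by rewrite -(bA _ aA).
have be' : deg ord0 b = e by apply: (tight_deg (i := ord_max) (a := a)).
have e_gt0 : 0 < e by case: orders => -[_ ->].
have [|||B [bB bB0 degB]] :=
    @block_of (fun i a => (a \notin A i) && (deg i a == e)) _ ord0 b.
- move=> i p q a' c uq /andP[aN /eqP ae] ca.
  by have [-> -> ->] := deg_e_neighbour uq aN ae ca; rewrite eqxx.
- by rewrite bN be' eqxx.
- by rewrite be'.
have B_card j l : l != j -> (exists x, x \in B l) -> #|B j| = e.
  by move=> lj [x xB]; rewrite (block_card bB lj xB); have /andP[_ /eqP] := degB l x xB.
have B_ne l : exists x, x \in B l.
  have [<-|il] := eqVneq ord0 l; first by exists b.
  by apply/set0Pn; rewrite -card_gt0 (B_card l ord0) //; exists b.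
exists B; split=> // j; split.
  have [||l] := @fresh_index [:: j] => //.
  by rewrite /= inE andbT => lj; apply: (B_card j l).
rewrite disjoint_sym disjoint_subset; apply/subsetP => c /degB /andP[cA _].
by rewrite inE.
Qed.

End SecondBlock.

(** For the complements, take a tight pair with one value in A and one in B: its
remaining values are those outside A and B. *)
Lemma three_blocks : exists A B C,
  [/\ block A, block B, block C &
      forall j, [/\ #|A j| = k, #|B j| = e, [disjoint A j & B j]
                  & C j = ~: (A j :|: B j)]].
Proof.
have [A [bA cA]] := first_block; have [B [bB cB]] := second_block bA cA.
exists A, B, (fun j => ~: (A j :|: B j)); split=> //; last first.
  by move=> j; have [? ?] := cB j; split.
move=> p q c pq; rewrite inE => cN.
have [i [j uq']] := complete_indices pq.
have uq : uniq [:: i; j; p; q] by rewrite -(rot_uniq 2).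
have [_ _ _ jp /andP[jq _]] := fourP uq.
have e_gt0 : 0 < e by case: orders => -[_ ->].
have /card_gt0P[b bBj] : 0 < #|B j| by rewrite (cB j).1.
have bN : b \notin A j by rewrite (disjointFl (cB j).2 bBj).
have be : deg j b <= e by rewrite -(block_card bB jp bBj) (cB p).1.
have [_ rest] := outside_pair bA cA uq bN be.
by rewrite (bB _ _ _ jp) // (bB _ _ _ jq) // in rest; apply: rest.
Qed.

End Extremal.
End Code.

(** * From arrays to codes and back *)

Section Words.
Variable n : nat.
Implicit Type M : pairarray n.

Definition row_ix : 'I_4 := @Ordinal 4 0 isT.
Definition col_ix : 'I_4 := @Ordinal 4 1 isT.
Definition fst_ix : 'I_4 := @Ordinal 4 2 isT.
Definition snd_ix : 'I_4 := @Ordinal 4 3 isT.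

Definition word r c y z : {ffun 'I_4 -> 'I_n} :=
  [ffun l => tnth [tuple r; c; y; z] l].

Lemma word_row r c y z : word r c y z row_ix = r. Proof. by rewrite ffunE. Qed.
Lemma word_col r c y z : word r c y z col_ix = c. Proof. by rewrite ffunE. Qed.
Lemma word_fst r c y z : word r c y z fst_ix = y. Proof. by rewrite ffunE. Qed.
Lemma word_snd r c y z : word r c y z snd_ix = z. Proof. by rewrite ffunE. Qed.
Definition wordE := (word_row, word_col, word_fst, word_snd).

Lemma index_cases (P : 'I_4 -> Prop) :
  P row_ix -> P col_ix -> P fst_ix -> P snd_ix -> forall l, P l.
Proof.
move=> Pr Pc Py Pz l; have := @four_indices [:: row_ix; col_ix; fst_ix; snd_ix] l.
by rewrite !inE => /(_ isT erefl)/or4P[]/eqP->.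
Qed.

Definition words M : {set {ffun 'I_4 -> 'I_n}} :=
  [set x : {ffun 'I_4 -> 'I_n} |
    M (x row_ix) (x col_ix) == Some (x fst_ix, x snd_ix)].

Lemma wordsP M (x : {ffun 'I_4 -> 'I_n}) :
  reflect (M (x row_ix) (x col_ix) = Some (x fst_ix, x snd_ix)) (x \in words M).
Proof. by rewrite inE; apply: eqP. Qed.

Lemma mem_word M r c y z : M r c = Some (y, z) -> word r c y z \in words M.
Proof. by move=> Mrc; apply/wordsP; rewrite !wordE. Qed.

Lemma first_entriesE M r c : first_entries M r c = omap fst (M r c).
Proof. by rewrite mxE. Qed.

Lemma second_entriesE M r c : second_entries M r c = omap snd (M r c).
Proof. by rewrite mxE. Qed.

Lemma first_entryP M r c y : first_entries M r c = Some y ->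
  exists z, word r c y z \in words M.
Proof.
rewrite first_entriesE; case E: (M r c) => [[y' z]|] //= -[<-].
by exists z; apply: mem_word.
Qed.

Lemma second_entryP M r c z : second_entries M r c = Some z ->
  exists y, word r c y z \in words M.
Proof.
rewrite second_entriesE; case E: (M r c) => [[y z']|] //= -[<-].
by exists y; apply: mem_word.
Qed.

Lemma OPLS_separated M : is_OPLS M <-> separated (words M).
Proof.
split=> [[[Frow Fcol] [Srow Scol] pairs] x y i j|sep].
  move=> /wordsP xM /wordsP yM.
  have xF : first_entries M (x row_ix) (x col_ix) = Some (x fst_ix).
    by rewrite first_entriesE xM.
  have yF : first_entries M (y row_ix) (y col_ix) = Some (y fst_ix).
    by rewrite first_entriesE yM.
  have xZ : second_entries M (x row_ix) (x col_ix) = Some (x snd_ix).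
    by rewrite second_entriesE xM.
  have yZ : second_entries M (y row_ix) (y col_ix) = Some (y snd_ix).
    by rewrite second_entriesE yM.
  move=> ij xyi xyj.
  suff [rE cE] : x row_ix = y row_ix /\ x col_ix = y col_ix.
    move: xM; rewrite rE cE yM => -[fE sE].
    by apply/ffunP; apply: index_cases.
  move: i j ij xyi xyj; apply: index_cases; apply: index_cases => // _ E1 E2.
  - by split=> //; apply: Frow xF _; rewrite E1 E2.
  - by split=> //; apply: Srow xZ _; rewrite E1 E2.
  - by split=> //; apply: Fcol xF _; rewrite E1 E2.
  - by split=> //; apply: Scol xZ _; rewrite E1 E2.
  - by split=> //; apply: Frow xF _; rewrite E1 E2.
  - by split=> //; apply: Fcol xF _; rewrite E1 E2.
  - by rewrite E1 E2 in xM; case: (pairs _ _ _ _ _ xM yM).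
  - by split=> //; apply: Srow xZ _; rewrite E1 E2.
  - by split=> //; apply: Scol xZ _; rewrite E1 E2.
  - by rewrite E1 E2 in xM; case: (pairs _ _ _ _ _ xM yM).
have agree i j r c y z r' c' y' z' : word r c y z \in words M ->
    word r' c' y' z' \in words M -> i != j ->
    word r c y z i = word r' c' y' z' i -> word r c y z j = word r' c' y' z' j ->
    r = r' /\ c = c'.
  move=> w w' ij wi wj; have /ffunP E := sep _ _ _ _ w w' ij wi wj.
  by have := E row_ix; have := E col_ix; rewrite !wordE.
split; [split|split|].
- move=> r c c' y /first_entryP[z w] /first_entryP[z' w'].
  by case: (@agree row_ix fst_ix _ _ _ _ _ _ _ _ w w'); rewrite ?wordE.
- move=> r c c' y /first_entryP[z w] /first_entryP[z' w'].
  by case: (@agree col_ix fst_ix _ _ _ _ _ _ _ _ w w'); rewrite ?wordE.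
- move=> r c c' y /second_entryP[z w] /second_entryP[z' w'].
  by case: (@agree row_ix snd_ix _ _ _ _ _ _ _ _ w w'); rewrite ?wordE.
- move=> r c c' y /second_entryP[z w] /second_entryP[z' w'].
  by case: (@agree col_ix snd_ix _ _ _ _ _ _ _ _ w w'); rewrite ?wordE.
- move=> r c r' c' [y z] /mem_word w /mem_word w'.
  by case: (@agree fst_ix snd_ix _ _ _ _ _ _ _ _ w w'); rewrite ?wordE // => -> ->.
Qed.

Lemma words_insert M (t : {ffun 'I_4 -> 'I_n}) : M (t row_ix) (t col_ix) = None ->
  words (insert_entry M (t row_ix) (t col_ix) (t fst_ix, t snd_ix))
    = t |: words M.
Proof.
move=> tN; apply/setP => x; rewrite !inE mxE.
have [->|xt] := eqVneq x t; first by rewrite !eqxx.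
case: ifP => //= /andP[/eqP rE /eqP cE]; rewrite rE cE tN.
apply/eqP => -[fE sE]; case/eqP: xt.
by apply/ffunP; apply: index_cases.
Qed.

(** If the cell of the quadruple is filled, the word there meets it twice.  If it is
empty and no word meets the quadruple twice, inserting it keeps the code separated,
against maximality. *)
Lemma MOPLS_covering M : is_MOPLS M -> covering (words M).
Proof.
case=> /OPLS_separated sep maxM t.
case: (boolP [exists x in words M, exists i : 'I_4, exists j : 'I_4,
  [&& i != j, x i == t i & x j == t j]]) => [|none].
  move=> /exists_inP[x xM /existsP[i /existsP[j /and3P[ij /eqP xi /eqP xj]]]].
  by exists x, i, j.
have far x i j : x \in words M -> i != j -> x i = t i -> x j = t j -> False.
  move=> xM ij xi xj; case/negP: none; apply/exists_inP; exists x => //.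
  by apply/existsP; exists i; apply/existsP; exists j; rewrite ij xi xj !eqxx.
case tM: (M (t row_ix) (t col_ix)) => [[y z]|].
  by case: (far _ row_ix col_ix (mem_word tM)); rewrite ?wordE.
case: (maxM _ _ (t fst_ix, t snd_ix) tM); apply/OPLS_separated.
rewrite words_insert // => x y i j /setU1P[->|xM] /setU1P[->|yM] ij xyi xyj //.
- by case: (far y i j).
- by case: (far x i j).
- exact: (sep x y i j).
Qed.

Lemma card_words M : is_OPLS M -> #|words M| = #|filled M|.
Proof.
move=> /OPLS_separated sep.
rewrite -(card_in_imset (f := fun x : {ffun 'I_4 -> 'I_n} => (x row_ix, x col_ix))
  (D := words M)); last first.
  by move=> x y xM yM [xyr xyc]; apply: (sep x y row_ix col_ix).
apply: eq_card => -[r c]; rewrite inE /=; apply/imsetP/idP.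
  by case=> x /wordsP xM [-> ->]; rewrite xM.
case E: (M r c) => [[y z]|] // _.
by exists (word r c y z); rewrite ?wordE //; apply: mem_word.
Qed.

Lemma block_word (S : {set {ffun 'I_4 -> 'I_n}}) B (i j : 'I_4) a b :
  block S B -> i != j -> a \in B i -> b \in B j ->
  exists x, [/\ x \in S, x i = a, x j = b & forall l, x l \in B l].
Proof.
move=> bB ij aB bBj; have /nbrP[x [xS xi xj]] : b \in nbr S i a j by rewrite (bB i j).
by exists x; split=> // l; apply: (block_closed (i := i) l bB xS); rewrite xi.
Qed.

(** Each Latin square condition asks for the word through two given values of a
block. *)
Lemma block_LS M L B k s : is_PLS L -> row_ix != s -> col_ix != s ->
  (forall x, x \in words M -> L (x row_ix) (x col_ix) = Some (x s)) ->
  block (words M) B -> (forall l, #|B l| = k) ->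
  is_LS_on L (B row_ix) (B col_ix) (B s) k.
Proof.
move=> [Lrow Lcol] rs cs LM bB cB; split=> //.
- move=> r c rB cB'.
  have [x [xM <- <- xB]] := block_word bB (isT : row_ix != col_ix) rB cB'.
  by exists (x s); [apply: xB|apply: LM].
- move=> r y rB yB; have [x [xM <- <- xB]] := block_word bB rs rB yB.
  by exists (x col_ix); split=> [|c [_]]; rewrite ?LM //; apply: Lrow; apply: LM.
- move=> c y cB' yB; have [x [xM <- <- xB]] := block_word bB cs cB' yB.
  by exists (x row_ix); split=> [|r [_]]; rewrite ?LM //; apply: Lcol; apply: LM.
Qed.

Lemma block_OLS M B k : is_OPLS M -> block (words M) B -> (forall l, #|B l| = k) ->
  is_OLS_on M (B row_ix) (B col_ix) (B fst_ix) (B snd_ix) k.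
Proof.
move=> [Lfst Lsnd pairs] bB cB; split.
- by apply: (@block_LS M) => // x /wordsP xM; rewrite first_entriesE xM.
- by apply: (@block_LS M) => // x /wordsP xM; rewrite second_entriesE xM.
- move=> y z yB zB.
  have [x [/wordsP xM xy xz xB]] := block_word bB (isT : fst_ix != snd_ix) yB zB.
  rewrite xy xz in xM; exists (x row_ix, x col_ix).
  by split=> [|[r c] [_ /= /(pairs _ _ _ _ _ xM)]]; rewrite // in_setX !xB.
Qed.

End Words.

(** * The decomposition *)

Theorem theorem2p3 (n : nat) (hn : 21 <= n) (M : pairarray n)
    (hM : is_minimum_MOPLS M) :
  exists k : 'I_3 -> nat,
    [/\ partitioned_into_three_OLSs M k,
        \sum_(i < 3) k i = n
      & forall i, k i = n %/ 3 \/ k i = (n %/ 3).+1].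
Proof.
have [mM fM] := hM; have [opls _] := mM; have sep := (OPLS_separated M).1 opls.
have [sizeE orders] := minimum_size n.
have k_gt0 : 0 < n %/ 3 by rewrite divn_gt0 // (leq_trans _ hn).
rewrite -card_words // sizeE in fM.
have := @three_blocks _ (words M) sep (MOPLS_covering mM) (n %/ 3)
  ((n - n %/ 3)./2) k_gt0; rewrite card_ord => /(_ orders fM).
move=> [A [B [C [bA bB bC ABC]]]].
have cC l : #|C l| = n - n %/ 3 - (n - n %/ 3)./2.
  have [cA cB dAB ->] := ABC l.
  by rewrite card_setCU card_ord cA (setDidPl _) ?cB // disjoint_sym.
pose P (m : 'I_3) := nth A [:: A; B; C] m.
pose k (m : 'I_3) := nth 0 [:: n %/ 3; (n - n %/ 3)./2;
  n - n %/ 3 - (n - n %/ 3)./2] m.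
have bP m : block (words M) (P m) by move: m; apply: part_cases.
have cP m l : #|P m l| = k m.
  by move: m; apply: part_cases; rewrite /P /k /=; have [] := ABC l.
have covP l a : exists m, a \in P m l.
  have [_ _ _ CE] := ABC l.
  case aA: (a \in A l); first by exists (@Ordinal 3 0 isT).
  case aB: (a \in B l); first by exists (@Ordinal 3 1 isT).
  by exists (@Ordinal 3 2 isT); rewrite /P /= CE !inE aA aB.
have partP l : is_indexed_partition (fun m => P m l).
  have [_ _ dAB CE] := ABC l; split.
    have dAC : [disjoint A l & C l] by rewrite CE disjoints_subset setCK subsetUl.
    have dBC : [disjoint B l & C l] by rewrite CE disjoints_subset setCK subsetUr.
    by apply: part_cases; apply: part_cases => //= _; rewrite /P /= // disjoint_sym.
  apply/setP => a; rewrite inE; apply/bigcupP.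
  by have [m am] := covP l a; exists m.
exists k; split.
- exists (P^~ row_ix), (P^~ col_ix), (P^~ fst_ix), (P^~ snd_ix); split=> //.
    apply/setP => -[r c]; rewrite inE /=; apply/idP/bigcupP.
      case Mrc: (M r c) => [[y z]|] // _; have w := mem_word Mrc.
      have [m rm] := covP row_ix r; exists m => //; rewrite in_setX rm /=.
      rewrite -(word_row r c y z) in rm.
      by have := block_closed col_ix (bP m) w rm; rewrite word_col.
    move=> [m _]; rewrite in_setX => /andP[rm cm].
    have [x [/wordsP xM <- <- _]] := block_word (bP m) (isT : row_ix != col_ix) rm cm.
    by rewrite xM.
  by move=> m; apply: block_OLS.
- by rewrite !big_ord_recl big_ord0 /k /=; lia.
- by apply: part_cases; rewrite /k /=; case: orders => -[? ?]; lia.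
Qed.
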